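(* Let $\alpha\in(0,1)$, $T>0$ and $h>0$. Suppose that $f\in C([0,T]\times\mathbb{R}^2,\mathbb{R})$, that $g\in C([0,T],[-h,T])$ satisfies $g(t)\le t$ for all $t\in[0,T]$, and that there is a constant $L>0$ such that $$|f(t,u_1,w_1)-f(t,u_2,w_2)|\le L\big(|u_1-u_2|+|w_1-w_2|\big)$$ for all $u_1,u_2,w_1,w_2\in\mathbb{R}$ and all $t\in[0,T]$. Then the equation $${}^{c}D^{\alpha}\upsilon(t)=f(t,\upsilon(t),\upsilon(g(t))),\qquad t\in[0,T],$$ is Hyers–Ulam stable; that is, there exists a real number $c>0$ such that for each $\epsilon>0$ and each solution $\vartheta\in C([-h,T],\mathbb{R})$ of the inequality $$\left|{}^{c}D^{\alpha}\vartheta(t)-f(t,\vartheta(t),\vartheta(g(t)))\right|\le\epsilon,\qquad t\in[0,T],$$ there exists a solution $\upsilon\in C([-h,T],\mathbb{R})$ of the equation with $$|\vartheta(t)-\upsilon(t)|\le c\,\epsilon\qquad\text{for all } t\in[-h,T].$$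
   Context: ${}^{c}D^{\alpha}$ denotes the Caputo fractional derivative of order $\alpha\in(0,1)$ with base point $0$, which for sufficiently regular $\upsilon$ is ${}^{c}D^{\alpha}\upsilon(t)=\frac{1}{\Gamma(1-\alpha)}\int_0^t(t-s)^{-\alpha}\upsilon'(s)\,ds$. The Riemann–Liouville integral is $I^{\alpha}q(t)=\frac{1}{\Gamma(\alpha)}\int_0^t(t-s)^{\alpha-1}q(s)\,ds$. Convention: for continuous $\upsilon$ and continuous $q:[0,T]\to\mathbb{R}$, the equation ${}^{c}D^{\alpha}\upsilon(t)=q(t)$ on $[0,T]$ is understood in its equivalent integral form $\upsilon(t)=\upsilon(0)+I^{\alpha}q(t)$ for all $t\in[0,T]$. Thus: (1) $\upsilon\in C([-h,T],\mathbb{R})$ is a solution of the equation if $\upsilon(t)=\upsilon(0)+\frac{1}{\Gamma(\alpha)}\int_0^t(t-s)^{\alpha-1}f(s,\upsilon(s),\upsilon(g(s)))\,ds$ for all $t\in[0,T]$ (no condition is prescribed on $[-h,0]$). (2) $\vartheta\in C([-h,T],\mathbb{R})$ is a solution of the inequality (for a given $\epsilon>0$) if and only if there exists $\Psi\in C([0,T],\mathbb{R})$ with $|\Psi(t)|\le\epsilon$ for all $t\in[0,T]$ and ${}^{c}D^{\alpha}\vartheta(t)=f(t,\vartheta(t),\vartheta(g(t)))+\Psi(t)$ on $[0,T]$, i.e. $\vartheta(t)=\vartheta(0)+\frac{1}{\Gamma(\alpha)}\int_0^t(t-s)^{\alpha-1}\big[f(s,\vartheta(s),\vartheta(g(s)))+\Psi(s)\big]ds$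 for all $t\in[0,T]$. The constant $c$ may depend on $\alpha,T,h,f,g,L$ but not on $\epsilon$ or $\vartheta$. *)

(* Defs.v *)
From HB Require Import structures.
From mathcomp Require Import all_boot all_order all_algebra.
From mathcomp Require Import all_classical all_reals all_analysis.
Import Order.TTheory GRing.Theory Num.Theory.
Import numFieldNormedType.Exports.

Set Implicit Arguments.
Unset Strict Implicit.
Unset Printing Implicit Defensive.

Local Open Scope classical_set_scope.
Local Open Scope ring_scope.

(* Euler's Gamma function, meant for [0 < x]. *)
Definition Gamma (R : realType) (x : R) : R :=
  (\int[lebesgue_measure]_(s in `]0%R, +oo[) (s `^ (x - 1) * expR (- s)))%R.

(* Lebesgue integral; at [s = t] the library sets [0 `^ (alpha - 1) = 0] when
   [alpha != 1], which is immaterial since a point is Lebesgue-null. *)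
Definition RL_integral (R : realType) (alpha : R) (q : R -> R) (t : R) : R :=
  (Gamma alpha)^-1 *
  (\int[lebesgue_measure]_(s in `[0%R, t]) ((t - s) `^ (alpha - 1) * q s))%R.

(* The equation "cD^alpha v = q on [0, T]", with base point 0, in its
   equivalent integral form. *)
Definition caputo_eq (R : realType) (alpha T : R) (v q : R -> R) : Prop :=
  forall t : R, t \in `[0, T] -> v t = v 0 + RL_integral alpha q t.

(* Elements of C([-h, T], R) are represented by total functions continuous on
   [-h, T]; their values outside [-h, T] are irrelevant. *)
Definition is_solution (R : realType) (alpha T h : R)
    (f : R -> R -> R -> R) (g v : R -> R) : Prop :=
  {within `[- h, T], continuous v} /\
  caputo_eq alpha T v (fun s => f s (v s) (v (g s))).

Definition is_ineq_solution (R : realType) (alpha T h : R)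
    (f : R -> R -> R -> R) (g : R -> R) (eps : R) (v : R -> R) : Prop :=
  {within `[- h, T], continuous v} /\
  exists Psi : R -> R,
    [/\ {within `[0, T], continuous Psi},
        forall t : R, t \in `[0, T] -> `|Psi t| <= eps
      & caputo_eq alpha T v (fun s => f s (v s) (v (g s)) + Psi s)].

Definition hyers_ulam_stable (R : realType) (alpha T h : R)
    (f : R -> R -> R -> R) (g : R -> R) : Prop :=
  exists c : R, 0 < c /\
    forall (eps : R) (theta : R -> R), 0 < eps ->
      is_ineq_solution alpha T h f g eps theta ->
      exists v : R -> R, is_solution alpha T h f g v /\
        forall t : R, t \in `[- h, T] -> `|theta t - v t| <= c * eps.

(* Main.v *)
(* Given an approximate solution [theta], the exact solution with the same
   history on [[- h, 0]] is the fixed point of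
     (V v)(t) = theta (min t 0) + I^alpha [f (s, v s, v (g s))] (max t 0).
   In the supremum norm weighted by [expR (lambda * t)] the operator [I^alpha]
   has norm at most a constant times [lambda `^ (- (alpha / 2))], and the delay
   is harmless since [g t <= t] makes the weight at [g t] at most the weight
   at [t].  So for [lambda] large [V] is a contraction moving [theta] by
   [O(eps)], and its fixed point lies within [O(eps)] of [theta]. *)

Require Import Defs.
From HB Require Import structures.
From mathcomp Require Import all_boot all_order all_algebra.
From mathcomp Require Import all_classical all_reals all_analysis.
From mathcomp Require Import measurable_realfun.
From mathcomp Require Import ring lra.
Import Order.TTheory GRing.Theory Num.Theory.
Import numFieldNormedType.Exports.

Local Open Scope classical_set_scope.
Local Open Scope ring_scope.

Set Implicit Arguments.
Unset Strict Implicit.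

(** * Integrals and integrability of the kernel [(t - s) ^ (alpha - 1)] *)

Lemma is_derive_powR_subl (R : realType) (alpha t x : R) : x < t ->
  is_derive x 1 (fun s => (t - s) `^ alpha)
    (- (alpha * (t - x) `^ (alpha - 1))).
Proof.
move=> xt; have tx : 0 < t - x by rewrite subr_gt0.
have dp := is_derive1_powR alpha tx.
have db : is_derive x (1 : R) (cst t - id) (-1 : R).
  by apply: is_derive_eq; rewrite add0r.
have := @is_derive1_comp R (@powR R ^~ alpha) (cst t - id) x _ _ dp db.
by rewrite mulrN1.
Qed.

(** Staying strictly below [t] keeps the antiderivative [- (t - s) ^ alpha / alpha] differentiable
    on all of [[a, b]], so the fundamental theorem of calculus applies. *)
Lemma integral_powR_subl_lt (R : realType) (alpha a b t : R) :
  0 < alpha -> a < b -> b < t ->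
  (\int[lebesgue_measure]_(s in `[a, b]) ((t - s) `^ (alpha - 1))%:E =
   (((t - a) `^ alpha - (t - b) `^ alpha) / alpha)%:E)%E.
Proof.
move=> alpha0 ab bt.
have cpow p : {within `[a, b], continuous (fun s => (t - s) `^ p)}.
  apply: derivable_within_continuous => x; rewrite in_itv/= => /andP[_ xb].
  by have [] := is_derive_powR_subl p (le_lt_trans xb bt).
pose F s := - alpha^-1 * (t - s) `^ alpha.
have dF x : x < t -> is_derive x 1 F ((t - x) `^ (alpha - 1)).
  move=> xt; have := is_derive_powR_subl alpha xt => D.
  have := @is_deriveZ _ _ _ (fun s => (t - s) `^ alpha) (- alpha^-1) x 1 _ D.
  rewrite /GRing.scale/= mulrNN mulrA mulVf ?mul1r ?gt_eqF//.
rewrite (@continuous_FTC2 _ _ F)//.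
- by rewrite -EFinB; congr EFin; rewrite /F; ring.
- have : {within `[a, b], continuous F}.
    apply: derivable_within_continuous => x; rewrite in_itv/= => /andP[_ xb].
    by have [] := dF x (le_lt_trans xb bt).
  move=> /(continuous_within_itvP _ ab)[_ Fa Fb]; split => // x.
  by rewrite in_itv/= => /andP[_ xb]; have [] := dF x (lt_trans xb bt).
- move=> x; rewrite in_itv/= => /andP[_ xb].
  by have [_ <-] := dF x (lt_trans xb bt); rewrite derive1E.
Qed.

Lemma measurable_powR_subl (R : realType) (t p : R) (D : set R) :
  measurable_fun D (fun s => (t - s) `^ p).
Proof.
apply: (@measurableT_comp _ _ _ _ _ _ (@powR R ^~ p)).
  exact: measurable_powR.
by apply: measurable_funB.
Qed.

(** The singular endpoint is a null set, and the remaining half-open interval is exhausted by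
    intervals [[a, b n]] with [b n] increasing to [t]. Monotone convergence applies because the
    kernel is nonnegative. *)
Lemma integral_powR_subl (R : realType) (alpha a t : R) : 0 < alpha -> a <= t ->
  (\int[lebesgue_measure]_(s in `[a, t]) ((t - s) `^ (alpha - 1))%:E =
   ((t - a) `^ alpha / alpha)%:E)%E.
Proof.
move=> alpha0; rewrite le_eqVlt => /predU1P[->|at_].
  by rewrite set_itv1 integral_set1 subrr powR0 ?gt_eqF// mul0r.
rewrite -integral_itv_bndo_bndc; last first.
  by apply/measurable_EFinP; exact: measurable_powR_subl.
(* The shift by two makes [a < b n] strict already at [n = 0], as the non-singular formula
   demands. *)
pose b (n : nat) := t - (t - a) / n.+2%:R.
have ta0 : 0 < t - a by rewrite subr_gt0.
have bt n : b n < t by rewrite /b ltrBlDr ltrDl divr_gt0.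
have ab n : a < b n.
  rewrite /b ltrBrDl -ltrBrDr ltr_pdivrMr// ltr_pMr// ltr1n//.
have -> : `[a, t[%classic = \bigcup_n `[a, b n]%classic.
  apply/seteqP; split => [x /=|x [n _] /=]; rewrite !in_itv/=.
    move=> /andP[ax xt].
    have tx0 : 0 < t - x by rewrite subr_gt0.
    (* [x <= b n] amounts to [(t - a) / (t - x) <= n + 2], which truncation ensures. *)
    exists (Num.truncn ((t - a) / (t - x))) => //=; rewrite in_itv/= ax/= /b.
    rewrite lerBrDl -lerBrDr ler_pdivrMr// mulrC -ler_pdivrMr//.
    apply: (le_trans (ltW (truncnS_gt _))).
    by rewrite ler_nat.
  by move=> /andP[-> xb] /=; exact: le_lt_trans (bt n).
have b_ge m n : (m <= n)%N -> b m <= b n.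
  move=> mn; rewrite /b lerB// (ler_wpM2l (ltW ta0))// lef_pV2 ?posrE// ler_nat.
  by rewrite !ltnS.
have intb : ((\int[lebesgue_measure]_(s in `[a, b n])
      ((t - s) `^ (alpha - 1))%:E)%E @[n --> \oo] -->
    (\int[lebesgue_measure]_(s in \bigcup_n `[a, b n]%classic)
      ((t - s) `^ (alpha - 1))%:E)%E).
  apply: ge0_nondecreasing_set_cvg_integral => //.
  - move=> m n mn; apply/subsetPset => x /=; rewrite !in_itv/=.
    by move=> /andP[-> /le_trans] /=; apply; exact: b_ge.
  - by move=> n; apply/measurable_EFinP; exact: measurable_powR_subl.
  - by move=> n x _; rewrite lee_fin powR_ge0.
have intbE : (fun n => (\int[lebesgue_measure]_(s in `[a, b n])
      ((t - s) `^ (alpha - 1))%:E)%E) =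
    EFin \o (fun n => (t - a) `^ alpha / alpha - (t - b n) `^ alpha / alpha).
  by apply/funext => n /=; rewrite integral_powR_subl_lt// mulrBl.
rewrite intbE in intb; apply: (cvg_unique (@ereal_hausdorff R) intb).
have tb0 : (t - b n) `^ alpha @[n --> \oo] --> (0 : R).
  apply: (cvg_at_rightP _ _ _).1 (powR_cvg0 alpha0) _ _; split => [n|].
    by rewrite subr_gt0.
  have -> : (fun n => t - b n) = (fun n => (t - a) * harmonic n.+1).
    by apply/funext => n; rewrite /b /harmonic/=; ring.
  have : (t - a) * harmonic n.+1 @[n --> \oo] --> (t - a) * 0.
    by apply: cvgMr; rewrite (@cvg_shiftS R^o harmonic); exact: cvg_harmonic.
  by rewrite mulr0.
apply: cvg_EFin; first exact: nearW.
have : (t - a) `^ alpha / alpha - (t - b n) `^ alpha / alpha @[n --> \oo] -->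
    (t - a) `^ alpha / alpha - 0 / alpha.
  by apply: cvgB; [exact: cvg_cst|exact: cvgMl].
by rewrite mul0r subr0.
Qed.

Lemma integrable_powR_subl (R : realType) (alpha a t : R) : 0 < alpha ->
  (@lebesgue_measure R).-integrable `[a, t]
    (EFin \o (fun s => (t - s) `^ (alpha - 1))).
Proof.
move=> alpha0; have [at_|ta] := leP a t; last first.
  by rewrite set_itv_ge ?bnd_simp -?ltNge//; exact: integrable_set0.
apply/integrableP; split.
  by apply/measurable_EFinP; exact: measurable_powR_subl.
under eq_integral do rewrite /= ger0_norm ?powR_ge0//.
by rewrite integral_powR_subl// ltry.
Qed.

(** Subtracting the two integrals that run up to the singularity treats [b < t] and [b = t]
    alike. *)
Lemma Rintegral_powR_subl (R : realType) (alpha a b t : R) :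
  0 < alpha -> a <= b -> b <= t ->
  \int[lebesgue_measure]_(s in `[a, b]) ((t - s) `^ (alpha - 1)) =
  ((t - a) `^ alpha - (t - b) `^ alpha) / alpha.
Proof.
move=> alpha0 ab bt.
have full c : c <= t ->
    \int[lebesgue_measure]_(s in `[c, t]) ((t - s) `^ (alpha - 1)) =
    (t - c) `^ alpha / alpha.
  by move=> ct; rewrite /Rintegral integral_powR_subl.
have := @Rintegral_itvB R (fun s => (t - s) `^ (alpha - 1)) (BLeft a) (BRight t)
  b (integrable_powR_subl a t alpha0).
rewrite !bnd_simp => /(_ ab bt).
rewrite Rintegral_itv_obnd_cbnd; last first.
  apply: integrableS (integrable_powR_subl b t alpha0) => //.
  exact: subset_itv_oc_cc.
rewrite !full ?(le_trans ab bt)// => H; rewrite mulrBl; lra.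
Qed.

(** The endpoint [b] may stay below the singularity [t], because the Hölder estimate compares the
    kernels of two times on one interval. *)
Lemma integrable_powR_subl_mul (R : realType) (alpha a b t M : R) (q : R -> R) :
  0 < alpha -> b <= t -> measurable_fun `[a, b] q ->
  (forall s, s \in `[a, b] -> `|q s| <= M) ->
  (@lebesgue_measure R).-integrable `[a, b]
    (EFin \o (fun s => (t - s) `^ (alpha - 1) * q s)).
Proof.
move=> alpha0 bt mq qM.
apply: (@integrableMl _ _ R lebesgue_measure `[a, b]%classic _
  (EFin \o (fun s => (t - s) `^ (alpha - 1))) q) => //.
- apply: integrableS (integrable_powR_subl a t alpha0) => //.
  by apply: subset_itvl; rewrite bnd_simp.
- exists M; split; first exact: num_real.
  by move=> N MN s sab /=; apply: le_trans (ltW MN); exact: qM.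
Qed.

Lemma integrableZl_EFin d (T : measurableType d) (R : realType)
    (mu : {measure set T -> \bar R}) (D : set T) (c : R) (f : T -> R) :
  measurable D -> mu.-integrable D (EFin \o f) ->
  mu.-integrable D (EFin \o (fun x => c * f x)).
Proof. by move=> mD intf; have := integrableZl mD c intf. Qed.

Lemma integrableB_EFin d (T : measurableType d) (R : realType)
    (mu : {measure set T -> \bar R}) (D : set T) (f1 f2 : T -> R) :
  measurable D -> mu.-integrable D (EFin \o f1) ->
  mu.-integrable D (EFin \o f2) ->
  mu.-integrable D (EFin \o (fun x => f1 x - f2 x)).
Proof. by move=> mD int1 int2; have := integrableB mD int1 int2. Qed.

(** * Exponentially weighted bounds for the fractional integral *)

(** Passing to [1 + x >= 1] makes powers monotone in the exponent:
    [x ^ b <= (1 + x) ^ b <= 1 + x <= expR x]. *)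
Lemma powR_le_expR (R : realType) (x b : R) : 0 <= x -> 0 <= b <= 1 ->
  x `^ b <= expR x.
Proof.
move=> x0 /andP[b0 b1]; apply: le_trans (expR_ge1Dx x).
apply: (@le_trans _ _ ((1 + x) `^ b)).
  by apply: ge0_ler_powR => //; rewrite ?nnegrE//; lra.
rewrite -[leRHS]powRr1; last by lra.
by apply: ler_powR => //; lra.
Qed.

(* Half of the singularity absorbs the exponential, leaving a negative power
   of [lambda] that makes the integral operator a contraction. *)
Lemma powR_mul_expRN_le (R : realType) (alpha lambda u : R) :
  0 < alpha < 1 -> 0 < lambda -> 0 <= u ->
  u `^ (alpha - 1) * expR (- (lambda * u)) <=
  lambda `^ (- (alpha / 2)) * u `^ (alpha / 2 - 1).
Proof.
move=> /andP[alpha0 alpha1] lambda0; rewrite le_eqVlt => /predU1P[<-|u0].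
  (* At [u = 0] the convention [0 ^ (alpha - 1) = 0], valid for [alpha != 1], makes the left side
     vanish. *)
  rewrite [0 `^ (alpha - 1)]powR0 ?mul0r ?mulr_ge0 ?powR_ge0//.
  by rewrite subr_eq0 lt_eqF.
have -> : alpha - 1 = alpha / 2 + (alpha / 2 - 1) by lra.
rewrite powRD; last by rewrite (gt_eqF u0) implybT.
(* After cancelling [u ^ (alpha / 2 - 1)], the claim becomes [(lambda u) ^ (alpha / 2) <= expR
   (lambda u)]. *)
rewrite mulrAC ler_wpM2r ?powR_ge0// expRN ler_pdivrMr ?expR_gt0//.
rewrite powRN [leRHS]mulrC ler_pdivlMr ?powR_gt0//.
rewrite -powRM ?(ltW u0) ?(ltW lambda0)// [u * _]mulrC.
by apply: powR_le_expR; [rewrite mulr_ge0 ?ltW|apply/andP; split; lra].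
Qed.

Lemma within_continuous_bounded (R : realType) (a b : R) (q : R -> R) :
  {within `[a, b], continuous q} ->
  exists M, forall s, s \in `[a, b] -> `|q s| <= M.
Proof.
move=> cq; have [ab|ba] := leP a b; last first.
  by exists 0 => s; rewrite in_itv/= => /andP[? ?]; lra.
have cn : {within `[a, b], continuous (fun s => `|q s|)}.
  by move=> x; apply: cvg_norm; exact: cq.
by have [c _ cmax] := EVT_max ab cn; exists `|q c|.
Qed.

Lemma within_continuous_measurable_itv (R : realType) (a b c : R) (q : R -> R) :
  c <= b -> {within `[a, b], continuous q} -> measurable_fun `[a, c] q.
Proof.
move=> cb cq; apply: subspace_continuous_measurable_fun => //.
by apply: continuous_subspaceW cq; apply: subset_itvl; rewrite bnd_simp.
Qed.

Lemma continuous_expR_scale (R : realType) (lambda : R) :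
  continuous (fun s => expR (lambda * s)).
Proof.
move=> x; apply: (@continuous_comp _ _ _ (fun s => lambda * s) expR).
  by apply: cvgMr; exact: cvg_id.
exact: continuous_expR.
Qed.

(** Writing [expR (lambda s)] as [expR (lambda t)] times [expR (- lambda (t - s))] lets the
    pointwise bound with [u = t - s] replace the integrand by a kernel of order [alpha / 2], whose
    integral is explicit. *)
Lemma Rintegral_powR_mul_expR_le (R : realType) (alpha lambda t T : R) :
  0 < alpha < 1 -> 0 < lambda -> t \in `[0, T] ->
  \int[lebesgue_measure]_(s in `[0, t])
     ((t - s) `^ (alpha - 1) * expR (lambda * s)) <=
  lambda `^ (- (alpha / 2)) * (T `^ (alpha / 2) / (alpha / 2)) *
  expR (lambda * t).
Proof.
move=> halpha lambda0; have /andP[alpha0 alpha1] := halpha.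
rewrite in_itv/= => /andP[t0 tT].
have alpha20 : 0 < alpha / 2 by lra.
pose c := expR (lambda * t) * lambda `^ (- (alpha / 2)).
apply: (@le_trans _ _ (\int[lebesgue_measure]_(s in `[0, t])
    (c * (t - s) `^ (alpha / 2 - 1)))).
  apply: le_Rintegral => //.
  - apply: (@integrable_powR_subl_mul _ _ _ _ _ (expR (lambda * t))) => //.
      apply: (@within_continuous_measurable_itv _ _ t) => //.
      by apply: continuous_subspaceT; exact: continuous_expR_scale.
    move=> s; rewrite in_itv/= => /andP[s0 st].
    by rewrite ger0_norm ?expR_ge0// ler_expR ler_wpM2l// ltW.
  - by apply: integrableZl_EFin => //; exact: integrable_powR_subl.
  - move=> s /=; rewrite in_itv/= => /andP[s0 st].
    have -> : lambda * s = lambda * t + - (lambda * (t - s)) by ring.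
    rewrite expRD mulrCA /c -[leRHS]mulrA ler_wpM2l ?expR_ge0//.
    by apply: powR_mul_expRN_le => //; rewrite subr_ge0.
rewrite RintegralZl//; last exact: integrable_powR_subl.
rewrite Rintegral_powR_subl// subrr subr0 [0 `^ _]powR0 ?gt_eqF// subr0.
rewrite mulrC [in leRHS]mulrC /c [leRHS]mulrA mulrC ler_wpM2l//.
  by rewrite mulr_ge0 ?expR_ge0 ?powR_ge0.
by rewrite ler_pM2r ?invr_gt0// ge0_ler_powR ?nnegrE// ?(le_trans t0 tT) ?ltW.
Qed.

(** Serves both the contraction estimate and the estimate of the residual [Psi]. The absolute value
    keeps the bound independent of the sign of [Gamma alpha]. *)
Lemma RL_integralB_le (R : realType) (alpha lambda t T D : R) (q1 q2 : R -> R) :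
  0 < alpha < 1 -> 0 < lambda -> t \in `[0, T] ->
  {within `[0, T], continuous q1} -> {within `[0, T], continuous q2} ->
  0 <= D ->
  (forall s, s \in `[0, T] -> `|q1 s - q2 s| <= D * expR (lambda * s)) ->
  `|RL_integral alpha q1 t - RL_integral alpha q2 t| <=
  `|(Gamma alpha)^-1| * (T `^ (alpha / 2) / (alpha / 2)) *
  lambda `^ (- (alpha / 2)) * D * expR (lambda * t).
Proof.
move=> halpha lambda0 tT cq1 cq2 D0 q12; have /andP[alpha0 _] := halpha.
have /andP[t0 letT] : 0 <= t <= T by move: tT; rewrite in_itv.
have iq q : {within `[0, T], continuous q} ->
    (@lebesgue_measure R).-integrable `[0, t]
      (EFin \o (fun s => (t - s) `^ (alpha - 1) * q s)).
  move=> cq; have [M qM] := within_continuous_bounded cq.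
  apply: (@integrable_powR_subl_mul _ _ _ _ _ M) => //.
    exact: within_continuous_measurable_itv cq.
  move=> s; rewrite in_itv/= => /andP[s0 st]; apply: qM.
  by rewrite in_itv/= s0 (le_trans st).
have iexp : (@lebesgue_measure R).-integrable `[0, t]
    (EFin \o (fun s => (t - s) `^ (alpha - 1) * expR (lambda * s))).
  apply: iq; apply: continuous_subspaceT; exact: continuous_expR_scale.
rewrite /RL_integral -mulrBr normrM -!mulrA ler_wpM2l//.
rewrite -RintegralB//; try exact: iq.
apply: (le_trans (le_normr_Rintegral _ _)) => //.
  by apply: integrableB_EFin => //; exact: iq.
apply: (@le_trans _ _ (\int[lebesgue_measure]_(s in `[0, t])
    (D * ((t - s) `^ (alpha - 1) * expR (lambda * s))))).
  apply: le_Rintegral => //.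
  - apply: (@integrable_norm _ _ R lebesgue_measure `[0, t]%classic
      (fun s => (t - s) `^ (alpha - 1) * q1 s - (t - s) `^ (alpha - 1) * q2 s)).
    by apply: integrableB_EFin => //; exact: iq.
  - exact: integrableZl_EFin.
  - move=> s /=; rewrite in_itv/= => /andP[s0 st].
    rewrite -mulrBr normrM ger0_norm ?powR_ge0// mulrCA ler_wpM2l ?powR_ge0//.
    by apply: q12; rewrite in_itv/= s0 (le_trans st).
rewrite RintegralZl//.
apply: le_trans (ler_wpM2l D0 (Rintegral_powR_mul_expR_le halpha lambda0 tT)) _.
by rewrite le_eqVlt; apply/orP; left; apply/eqP; ring.
Qed.

(** * Hölder continuity of the fractional integral *)

Lemma powR_subr1_anti (R : realType) (alpha x y : R) : alpha < 1 ->
  0 < x -> x <= y -> y `^ (alpha - 1) <= x `^ (alpha - 1).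
Proof.
move=> alpha1 x0 xy; have y0 := lt_le_trans x0 xy.
rewrite -opprB !powRN lef_pV2 ?posrE ?powR_gt0//.
by apply: ge0_ler_powR; rewrite ?nnegrE ?(ltW x0) ?(ltW y0)//; lra.
Qed.

(** Split [[0, u]] at [t]. The part beyond [t] gives [M (u - t) ^ alpha / alpha]. Before [t] the
    kernel decreases when [t] grows to [u], so the kernel difference integrates to [(t ^ alpha - u ^
    alpha + (u - t) ^ alpha) / alpha], which obeys the same bound; hence the factor 2. *)
Lemma RL_integral_holder (R : realType) (alpha M t u T : R) (q : R -> R) :
  0 < alpha < 1 -> 0 <= t -> t <= u -> u <= T ->
  {within `[0, T], continuous q} ->
  (forall s, s \in `[0, T] -> `|q s| <= M) ->
  `|RL_integral alpha q u - RL_integral alpha q t| <=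
  `|(Gamma alpha)^-1| * M * (2 / alpha) * (u - t) `^ alpha.
Proof.
move=> /andP[alpha0 alpha1] t0 tu uT cq qM.
have M0 : 0 <= M.
  apply: le_trans (normr_ge0 (q 0)) (qM _ _).
  by rewrite in_itv/=; apply/andP; split; lra.
pose k (x s : R) := (x - s) `^ (alpha - 1).
have iqk x b : 0 <= b -> b <= x -> b <= u ->
    (@lebesgue_measure R).-integrable `[0, b] (EFin \o (fun s => k x s * q s)).
  move=> b0 bx bu; apply: (@integrable_powR_subl_mul _ _ _ _ _ M) => //.
    by apply: within_continuous_measurable_itv cq; exact: le_trans uT.
  move=> s; rewrite in_itv/= => /andP[s0 st]; apply: qM.
  by rewrite in_itv/=; apply/andP; split; lra.
have ik x b : b <= x ->
    (@lebesgue_measure R).-integrable `[0, b] (EFin \o (fun s => k x s)).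
  move=> bx; apply: integrableS (integrable_powR_subl 0 x alpha0) => //.
  by apply: subset_itvl; rewrite bnd_simp.
have sub0t : `[0, t[%classic `<=` `[0, t]%classic by exact: subset_itv_co_cc.
have ico f : (@lebesgue_measure R).-integrable `[0, t] (EFin \o f) ->
    (@lebesgue_measure R).-integrable `[0, t[ (EFin \o f).
  by apply: integrableS.
have subtu : `]t, u]%classic `<=` `[0, u]%classic.
  by apply: subset_itvr; rewrite bnd_simp.
have near_part : `|\int[lebesgue_measure]_(s in `]t, u]) (k u s * q s)| <=
    M * ((u - t) `^ alpha / alpha).
  have itu : (@lebesgue_measure R).-integrable `]t, u]
      (EFin \o (fun s => k u s * q s)).
    by apply: integrableS (iqk u u _ _ _) => //; exact: le_trans tu.
  have iktu : (@lebesgue_measure R).-integrable `]t, u]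
      (EFin \o (fun s => k u s)).
    by apply: integrableS (ik u u _).
  apply: (le_trans (le_normr_Rintegral _ _)) => //.
  apply: (@le_trans _ _ (\int[lebesgue_measure]_(s in `]t, u]) (M * k u s))).
    apply: le_Rintegral => //.
    - exact: integrable_norm.
    - exact: integrableZl_EFin.
    - move=> s /=; rewrite in_itv/= => /andP[ts su].
      rewrite normrM ger0_norm ?powR_ge0// mulrC ler_wpM2r ?powR_ge0//.
      by apply: qM; rewrite in_itv/=; apply/andP; split; lra.
  rewrite RintegralZl// Rintegral_itv_obnd_cbnd// Rintegral_powR_subl//.
  by rewrite subrr powR0 ?gt_eqF// subr0.
have far_part : `|\int[lebesgue_measure]_(s in `[0, t]) (k u s * q s) -
     \int[lebesgue_measure]_(s in `[0, t]) (k t s * q s)| <=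
    M * ((u - t) `^ alpha / alpha).
  (* The point [s = t] must go: there [k t s] is 0 by convention, and [k u s <= k t s] fails when
     [t < u]. *)
  rewrite -!Rintegral_itv_bndo_bndc; try by apply: ico; exact: iqk.
  rewrite -RintegralB//; try by apply: ico; exact: iqk.
  have iB : (@lebesgue_measure R).-integrable `[0, t[
      (EFin \o (fun s => k u s * q s - k t s * q s)).
    by apply: integrableB_EFin => //; apply: ico; exact: iqk.
  apply: (le_trans (le_normr_Rintegral _ _)) => //.
  apply: (@le_trans _ _ (\int[lebesgue_measure]_(s in `[0, t[)
      (M * (k t s - k u s)))).
    apply: le_Rintegral => //.
    - exact: integrable_norm.
    - apply: integrableZl_EFin => //; apply: integrableB_EFin => //;
        by apply: ico; exact: ik.
    - move=> s /=; rewrite in_itv/= => /andP[s0 st].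
      have k_anti : 0 <= k t s - k u s.
        by rewrite subr_ge0; apply: powR_subr1_anti => //; lra.
      rewrite -mulrBl normrM distrC (ger0_norm k_anti) mulrC ler_wpM2r//.
      by apply: qM; rewrite in_itv/=; apply/andP; split; lra.
  rewrite RintegralZl//; last first.
    by apply: integrableB_EFin => //; apply: ico; exact: ik.
  rewrite RintegralB//; try by apply: ico; exact: ik.
  rewrite !Rintegral_itv_bndo_bndc; try by apply: ico; exact: ik.
  rewrite !Rintegral_powR_subl// subrr [0 `^ _]powR0 ?gt_eqF// !subr0.
  rewrite ler_wpM2l// -mulrBl ler_wpM2r ?invr_ge0 ?(ltW alpha0)//.
  have : t `^ alpha <= u `^ alpha.
    by apply: ge0_ler_powR; rewrite ?nnegrE ?(ltW alpha0)//; lra.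
  lra.
have := @Rintegral_itvB R (fun s => k u s * q s) (BLeft 0) (BRight u) t
  (iqk u u (le_trans t0 tu) (lexx u) (lexx u)).
rewrite !bnd_simp => /(_ t0 tu) split_u.
rewrite /RL_integral -mulrBr normrM.
have -> : `|(Gamma alpha)^-1| * M * (2 / alpha) * (u - t) `^ alpha =
  `|(Gamma alpha)^-1| *
  (M * ((u - t) `^ alpha / alpha) + M * ((u - t) `^ alpha / alpha)) by ring.
rewrite ler_wpM2l//.
apply: le_trans (lerD near_part far_part); rewrite -split_u.
apply: le_trans (ler_normD _ _); rewrite le_eqVlt; apply/orP; left; apply/eqP.
by congr `|_|; rewrite addrA subrK.
Qed.

Lemma RL_integral_continuous (R : realType) (alpha T : R) (q : R -> R) :
  0 < alpha < 1 -> {within `[0, T], continuous q} ->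
  {within `[0, T], continuous (RL_integral alpha q)}.
Proof.
move=> halpha cq; have [M qM] := within_continuous_bounded cq.
have /andP[alpha0 _] := halpha.
apply/subspace_continuousP => t; rewrite /= in_itv/= => /andP[t0 tT].
set K := `|(Gamma alpha)^-1| * M * (2 / alpha).
have K0 : 0 <= K.
  have M0 : 0 <= M.
    by apply: le_trans (normr_ge0 (q t)) (qM _ _); rewrite in_itv/= t0.
  by rewrite !mulr_ge0// invr_ge0 ltW.
have bound u : u \in `[0, T] ->
    `|RL_integral alpha q t - RL_integral alpha q u| <= K * `|t - u| `^ alpha.
  rewrite in_itv/= => /andP[u0 uT]; have [tu|ut] := leP t u.
    rewrite distrC [`|t - u|]distrC [`|u - t|]ger0_norm ?subr_ge0//.
    exact: (RL_integral_holder (T := T)).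
  rewrite [`|t - u|]ger0_norm ?subr_ge0 ?(ltW ut)//.
  by apply: (RL_integral_holder (T := T)) => //; exact: ltW.
apply/cvgrPdist_le => e e0; rewrite near_withinE.
(* Chosen so that [d ^ alpha = e / (K + 1)]; adding 1 keeps the divisor positive when [K = 0]. *)
pose d := (e / (K + 1)) `^ alpha^-1.
have d0 : 0 < d by rewrite powR_gt0// divr_gt0// ltr_wpDl.
near=> u => uT; apply: le_trans (bound u uT) _.
have : `|t - u| `^ alpha <= e / (K + 1).
  have -> : e / (K + 1) = d `^ alpha.
    by rewrite /d -powRrM mulVf ?gt_eqF// powRr1// divr_ge0 ?ltW// ltr_wpDl.
  by apply: ge0_ler_powR; rewrite ?nnegrE ?(ltW alpha0) ?(ltW d0)//.
move/(ler_wpM2l K0)/le_trans; apply.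
by rewrite mulrCA ler_piMr ?(ltW e0)// ler_pdivrMr ?ltr_wpDl// mul1r lerDl.
Unshelve. all: by end_near. Qed.

(** * Fixed points of contractions in a weighted supremum norm *)

(** With [r n] the sum of the increment bounds from [n] on, the intervals of radius [r n] around
    [u n] are nested. The supremum of their left ends lies in all of them, which gives the limit
    together with its rate. *)
Lemma geometric_increments_limit (R : realType) (u : nat -> R) (K : R) :
  (forall n, `|u n.+1 - u n| <= K * 2^-1 ^+ n) ->
  exists l, forall n, `|u n - l| <= 2 * K * 2^-1 ^+ n.
Proof.
move=> uK.
pose r n : R := 2 * K * 2^-1 ^+ n.
have rS n : r n.+1 = r n - K * 2^-1 ^+ n by rewrite /r exprS; lra.
have r0 n : 0 <= r n.
  by rewrite /r -mulrA mulr_ge0//; exact: le_trans (uK n).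
pose lo n := u n - r n; pose up n := u n + r n.
have lo_nd : {homo lo : m n / (m <= n)%N >-> m <= n}.
  apply/nondecreasing_seqP => n; rewrite /lo rS.
  by have := uK n; rewrite ler_norml => /andP[? ?]; lra.
have up_ni : {homo up : m n / (m <= n)%N >-> n <= m}.
  apply/nonincreasing_seqP => n; rewrite /up rS.
  by have := uK n; rewrite ler_norml => /andP[? ?]; lra.
have lo_up m n : lo m <= up n.
  apply: (le_trans (lo_nd _ _ (leq_maxl m n))).
  apply: le_trans (up_ni _ _ (leq_maxr m n)).
  by have := r0 (maxn m n); rewrite /lo /up; lra.
exists (sup (range lo)) => n.
have ub : has_ubound (range lo) by exists (up 0%N) => _ [m _ <-].
have h1 : lo n <= sup (range lo) by apply: ub_le_sup => //; exists n.
have h2 : sup (range lo) <= up n.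
  by apply: ge_sup; [exists (lo 0%N), 0%N|move=> _ [m _ <-]].
by rewrite ler_norml -/(r n); move: h1 h2; rewrite /lo /up; lra.
Qed.

(** Picard iteration from [v0], with increments at most [D 2^-n w]. Boundedness of [w] makes the
    convergence uniform, so the limit is continuous; the factor 2 is the sum of the geometric
    series. Pointwise bounds stand in for a complete space of functions on [A]. *)
Lemma weighted_fixed_point (R : realType) (X : topologicalType) (A : set X)
    (Phi : (X -> R) -> X -> R) (w : X -> R) (W D : R) (v0 : X -> R) :
  (forall x, A x -> 0 <= w x <= W) ->
  (forall v, {within A, continuous v} -> {within A, continuous (Phi v)}) ->
  (forall v1 v2 d, 0 <= d ->
     {within A, continuous v1} -> {within A, continuous v2} ->
     (forall x, A x -> `|v1 x - v2 x| <= d * w x) ->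
     forall x, A x -> `|Phi v1 x - Phi v2 x| <= d / 2 * w x) ->
  {within A, continuous v0} -> 0 <= D ->
  (forall x, A x -> `|Phi v0 x - v0 x| <= D * w x) ->
  exists v, [/\ {within A, continuous v}, forall x, A x -> Phi v x = v x &
    forall x, A x -> `|v0 x - v x| <= 2 * D * w x].
Proof.
move=> wW Phi_cont Phi_contr cv0 D0 v0D.
pose v n := iter n Phi v0.
have cv n : {within A, continuous (v n)}.
  by elim: n => //= n IH; exact: Phi_cont.
have half0 n : (0 : R) <= 2^-1 ^+ n by rewrite exprn_ge0.
have vS n x : A x -> `|v n.+1 x - v n x| <= D * 2^-1 ^+ n * w x.
  elim: n x => [|n IH] x Ax; first by rewrite expr0 mulr1; exact: v0D.
  have := Phi_contr (v n.+1) (v n) (D * 2^-1 ^+ n) (mulr_ge0 D0 (half0 n))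
    (cv _) (cv _) IH x Ax.
  by rewrite exprS [2^-1 * _]mulrC [D * (_ * _)]mulrA.
(* The condition [A x] sits under the existential so that choice yields a total function [l]. *)
have lim_ex x : exists l, A x ->
    forall n, `|v n x - l| <= 2 * D * 2^-1 ^+ n * w x.
  have [Ax|nAx] := pselect (A x); last by exists 0.
  have [n|l vl] := @geometric_increments_limit R (fun n => v n x) (D * w x).
    by rewrite mulrAC; exact: vS.
  by exists l => _ n; move: (vl n); congr (_ <= _); ring.
have [l vl] := choice lim_ex.
have lim_unif (e : R) : 0 < e -> exists n, forall x, A x ->
    2 * D * 2^-1 ^+ n * w x <= e.
  move=> e0.
  have : (geometric (2 * D * `|W|) 2^-1) n @[n --> \oo] --> (0 : R).
    by apply: cvg_geometric; rewrite ger0_norm ?invr_ge0//; lra.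
  move/cvgrPdist_le => /(_ e e0)[n _ /(_ n (leqnn n))].
  rewrite /geometric/= sub0r normrN => ne; exists n => x Ax.
  have /andP[w0 wx] := wW x Ax.
  apply: le_trans (le_trans (ler_norm _) ne); rewrite mulrAC.
  rewrite ler_wpM2r// ler_wpM2l ?mulr_ge0//.
  exact: le_trans wx (ler_norm W).
have cl : {within A, continuous l}.
  apply/subspace_continuousP => x Ax; apply/cvgrPdist_le => e e0.
  have e3 : 0 < e / 3 by rewrite divr_gt0.
  have [n ne] := lim_unif _ e3.
  have /subspace_continuousP/(_ x Ax)/cvgrPdist_le/(_ _ e3) := cv n.
  rewrite !near_withinE; apply: filterS => y vy Ay.
  have := vy Ay; rewrite /from_subspace.
  have := le_trans (vl x Ax n) (ne x Ax).
  have := le_trans (vl y Ay n) (ne y Ay).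
  rewrite !ler_norml => /andP[? ?] /andP[? ?] /andP[? ?].
  by apply/andP; split; lra.
exists l; split => // x Ax.
  (* Compare [Phi l] and [l] through [v n.+1 = Phi (v n)]: one gap is small by contraction, the
     other by the convergence rate. *)
  apply/eqP; rewrite -subr_eq0 -normr_le0; apply/ler_addgt0Pl => e e0.
  rewrite addr0; have e2 : 0 < e / 2 by rewrite divr_gt0.
  have [n ne] := lim_unif _ e2.
  have := Phi_contr (v n) l (2 * D * 2^-1 ^+ n)
    (mulr_ge0 (mulr_ge0 (ler0n R 2) D0) (half0 n)) (cv n) cl
    (fun y Ay => vl y Ay n) x Ax.
  have : `|v n.+1 x - l x| <= e / 2.
    apply: le_trans (vl x Ax n.+1) (le_trans _ (ne x Ax)).
    have /andP[w0 _] := wW x Ax.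
    rewrite ler_wpM2r// ler_wpM2l ?mulr_ge0// exprS ler_piMl//; lra.
  have -> : Phi (v n) x = v n.+1 x by [].
  rewrite [_ / 2 * _]mulrAC; move: (ne x Ax).
  set r := _ * w x => r_le; rewrite !ler_norml => /andP[? ?] /andP[? ?].
  by apply/andP; split; lra.
by have := vl x Ax 0%N; rewrite expr0 mulr1.
Qed.

(** * Composition and pairing of functions continuous on a subset *)

(** Needed for the delayed term [v (g s)], where [v] is continuous only on [[-h, T]], and for [f],
    continuous only over [[0, T]]. *)
Lemma within_continuous_comp_sub (X Y Z : topologicalType) (A : set X)
    (B : set Y) (f : X -> Y) (g : Y -> Z) :
  {within A, continuous f} -> (forall x, A x -> B (f x)) ->
  {within B, continuous g} -> {within A, continuous (fun x => g (f x))}.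
Proof.
move=> /subspace_continuousP cf AB /subspace_continuousP cg.
apply/subspace_continuousP => x Ax; apply: cvg_trans (cg (f x) (AB x Ax)).
move=> U BU; have fBU : nbhs x (fun y => A y -> B (f y) -> U (g (f y))).
  exact: (cf x Ax _ BU).
change (nbhs x (fun y => A y -> U (g (f y)))).
by apply: filterS fBU => y BUy Ay; apply: BUy => //; exact: AB.
Qed.

Lemma within_continuous_pair (X Y Z : topologicalType) (A : set X)
    (f : X -> Y) (g : X -> Z) :
  {within A, continuous f} -> {within A, continuous g} ->
  {within A, continuous (fun x => (f x, g x))}.
Proof.
move=> /subspace_continuousP cf /subspace_continuousP cg.
by apply/subspace_continuousP => x Ax; apply: cvg_pair; [exact: cf|exact: cg].
Qed.

(** * Hyers-Ulam stability of the delay equation *)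

Unset Implicit Arguments.

Theorem theorem3 (R : realType) (alpha T h L : R)
    (f : R -> R -> R -> R) (g : R -> R)
    (halpha : 0 < alpha < 1) (hT : 0 < T) (hh : 0 < h)
    (hf : {within (`[0, T] `*` [set: R * R])%classic,
             continuous (fun p : R * (R * R) => f p.1 p.2.1 p.2.2)})
    (hg : {within `[0, T], continuous g})
    (hgr : forall t : R, t \in `[0, T] -> g t \in `[- h, T])
    (hgt : forall t : R, t \in `[0, T] -> g t <= t)
    (hL : 0 < L)
    (hLip : forall t u1 u2 w1 w2 : R, t \in `[0, T] ->
       `|f t u1 w1 - f t u2 w2| <= L * (`|u1 - u2| + `|w1 - w2|)) :
  hyers_ulam_stable alpha T h f g.
Proof.
have /andP[alpha0 _] := halpha.
have alpha20 : 0 < alpha / 2 by lra.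
pose C := `|(Gamma alpha)^-1| * (T `^ (alpha / 2) / (alpha / 2)).
have C0 : 0 <= C by rewrite !mulr_ge0 ?powR_ge0// invr_ge0 ltW.
(* [lambda] below solves [lambda ^ (- (alpha / 2)) = 1 / B], giving the integral operator weighted
   norm at most [C / B]. Since [4 L C <= B], the Lipschitz factor [2 L] then leaves a contraction
   constant of at most 1/2. *)
pose B := 1 + 4 * L * C.
have B1 : 1 <= B by have := mulr_ge0 (ltW hL) C0; rewrite /B; lra.
have CB0 : 0 <= C / B by rewrite divr_ge0//; lra.
pose lambda := B `^ (alpha / 2)^-1.
have lambda0 : 0 < lambda by rewrite powR_gt0//; lra.
have lambdaE : lambda `^ (- (alpha / 2)) = B^-1.
  by rewrite powRN /lambda -powRrM mulVf ?gt_eqF// powRr1//; lra.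
have RL_le q1 q2 t D : t \in `[0, T] ->
    {within `[0, T], continuous q1} -> {within `[0, T], continuous q2} ->
    0 <= D ->
    (forall s, s \in `[0, T] -> `|q1 s - q2 s| <= D * expR (lambda * s)) ->
    `|RL_integral alpha q1 t - RL_integral alpha q2 t| <=
    C / B * D * expR (lambda * t).
  move=> tT cq1 cq2 D0 q12; rewrite -lambdaE.
  exact: RL_integralB_le halpha lambda0 tT cq1 cq2 D0 q12.
have CB : 2 * L * (C / B) <= 1 / 2.
  rewrite mulrA ler_pdivrMr ?(lt_le_trans ltr01 B1)// /B.
  by have := mulr_ge0 (ltW hL) C0; lra.
have sub0T t : t \in `[0, T] -> t \in `[- h, T].
  by rewrite !in_itv/= => /andP[? ?]; apply/andP; split; lra.
pose F (v : R -> R) s := f s (v s) (v (g s)).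
have cF v : {within `[- h, T], continuous v} ->
    {within `[0, T], continuous (F v)}.
  move=> cv.
  have cv0 : {within `[0, T], continuous v}.
    by apply: continuous_subspaceW cv => x /=; exact: sub0T.
  have cvg : {within `[0, T], continuous (fun s => v (g s))}.
    exact: within_continuous_comp_sub hg hgr cv.
  apply: (@within_continuous_comp_sub _ _ _ _ (`[0, T] `*` [set: R * R])%classic
    (fun s => (s, (v s, v (g s))))
    (fun p : R * (R * R) => f p.1 p.2.1 p.2.2)) hf => //.
  apply: within_continuous_pair; last exact: within_continuous_pair cv0 cvg.
  by apply: continuous_subspaceT => y; exact: cvg_id.
(* Twice the weighted residual [C / B], times the largest weight on [[-h, T]]; the added 1 secures
   strict positivity. *)
exists (2 * (C / B) * expR (lambda * T) + 1); split.
  by rewrite ltr_wpDl// mulr_ge0 ?expR_ge0// mulr_ge0.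
move=> eps theta eps0 [ctheta [Psi [cPsi Psi_le theta_eq]]].
(* Clamping time freezes one summand on each side of 0, so continuity of [V v] follows by
   composition, without gluing. *)
pose V v t := theta (Num.min t 0) + RL_integral alpha (F v) (Num.max t 0).
have max_itv t : t \in `[- h, T] -> Num.max t 0 \in `[0, T].
  by rewrite !in_itv/= le_max ge_max lexx orbT => /andP[_ ->]; rewrite (ltW hT).
have min_itv t : t \in `[- h, T] -> Num.min t 0 \in `[- h, T].
  rewrite !in_itv/= le_min ge_min => /andP[-> ->].
  by rewrite oppr_le0 (ltW hh).
have RL0 q : RL_integral alpha q 0 = 0.
  by rewrite /RL_integral set_itv1 Rintegral_set1 mulr0.
have cV v : {within `[- h, T], continuous v} ->
    {within `[- h, T], continuous (V v)}.
  move=> cv.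
  have cmin : {within `[- h, T], continuous (fun t : R => Num.min t 0)}.
    apply: continuous_subspaceT => x.
    by apply: continuous_min; [exact: cvg_id|exact: cvg_cst].
  have cmax : {within `[- h, T], continuous (fun t : R => Num.max t 0)}.
    apply: continuous_subspaceT => x.
    by apply: continuous_max; [exact: cvg_id|exact: cvg_cst].
  have := within_continuous_comp_sub cmax max_itv
    (RL_integral_continuous halpha (cF v cv)).
  have := within_continuous_comp_sub cmin min_itv ctheta.
  exact: within_continuousD.
have V_pos v t : t \in `[0, T] -> V v t = theta 0 + RL_integral alpha (F v) t.
  rewrite in_itv => /andP[t0 _]; rewrite /V.
  by rewrite (min_idPr t0) (max_idPl t0).
have V_neg v t : t <= 0 -> V v t = theta t.
  by move=> t0; rewrite /V min_l// max_r// RL0 addr0.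
have V_contr v1 v2 d : 0 <= d ->
    {within `[- h, T], continuous v1} -> {within `[- h, T], continuous v2} ->
    (forall t, `[- h, T]%classic t ->
       `|v1 t - v2 t| <= d * expR (lambda * t)) ->
    forall t, `[- h, T]%classic t ->
      `|V v1 t - V v2 t| <= d / 2 * expR (lambda * t).
  move=> d0 cv1 cv2 v12 t tT; have [t0|t0] := leP t 0.
    by rewrite !V_neg// subrr normr0 mulr_ge0 ?expR_ge0// divr_ge0.
  have t0T : t \in `[0, T].
    by move: tT; rewrite /= !in_itv/= (ltW t0) => /andP[].
  rewrite !V_pos// opprD addrACA subrr add0r.
  (* The current and the delayed value each differ by at most [d] times the weight at [s], whence
     [2 L d]. *)
  have Ld0 : 0 <= 2 * L * d by rewrite !mulr_ge0// ltW.
  apply: le_trans (RL_le _ _ _ _ t0T (cF _ cv1) (cF _ cv2) Ld0 _) _.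
    move=> s sT; apply: le_trans (hLip _ _ _ _ _ sT) _.
    rewrite [2 * L]mulrC -!mulrA ler_wpM2l ?(ltW hL)// mulr_natl mulr2n lerD//.
      exact/v12/sub0T.
    apply: le_trans (v12 _ (hgr _ sT)) _.
    by rewrite ler_wpM2l// ler_expR ler_wpM2l ?(ltW lambda0)// hgt.
  rewrite ler_wpM2r ?expR_ge0//.
  by have := ler_wpM2l d0 CB; lra.
have V_theta t : `[- h, T]%classic t ->
    `|V theta t - theta t| <= C / B * eps * expR (lambda * t).
  move=> tT; have [t0|t0] := leP t 0.
    by rewrite V_neg// subrr normr0 mulr_ge0 ?expR_ge0// mulr_ge0 ?(ltW eps0).
  have t0T : t \in `[0, T].
    by move: tT; rewrite /= !in_itv/= (ltW t0) => /andP[].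
  rewrite V_pos// (theta_eq t t0T) opprD addrACA subrr add0r.
  apply: RL_le => //; [exact: cF| |exact: ltW|].
    by apply: within_continuousD => //; exact: cF.
  (* The integrands differ by [- Psi], and [eps <= eps * expR (lambda * s)] because [s >= 0]. *)
  move=> s sT; rewrite opprD addNKr normrN.
  apply: le_trans (Psi_le s sT) _; rewrite ler_peMr ?(ltW eps0)//.
  rewrite -[leLHS]expR0 ler_expR mulr_ge0 ?(ltW lambda0)//.
  by move: sT; rewrite in_itv/= => /andP[].
have CBeps0 : 0 <= C / B * eps by rewrite mulr_ge0 ?(ltW eps0).
have w_le t : `[- h, T]%classic t ->
    0 <= expR (lambda * t) <= expR (lambda * T).
  rewrite /= in_itv/= => /andP[_ tT].
  by rewrite expR_ge0 ler_expR ler_wpM2l// ltW.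
have [v [cv Vv v_le]] :=
  weighted_fixed_point w_le cV V_contr ctheta CBeps0 V_theta.
exists v; split.
  split=> // t t0T.
  have T0 : 0 \in `[0, T] by rewrite in_itv/= lexx ltW.
  (* The fixed point satisfies [v 0 = theta 0], so the equation [V v = v] carries the initial value
     of [v] itself. *)
  rewrite -(Vv t (sub0T _ t0T)) -(Vv 0 (sub0T _ T0)) V_pos//.
  by rewrite (V_neg v 0).
move=> t tT; apply: le_trans (v_le t tT) _.
have /andP[_ wT] := w_le t tT.
apply: (@le_trans _ _ (2 * (C / B * eps) * expR (lambda * T))).
  by rewrite ler_wpM2l// mulr_ge0.
by lra.
Qed.
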